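(* There exists $N$ such that the following holds for every even $n \ge N$: if $G = I \vee T$ is the join of an independent set $I$ and a triangle-free graph $T$, with $|G| = n$, then $D_{2,\infty}^b(G) \le \frac{5}{72} n^2$.
   Context: All graphs are simple. The join $G_1 \vee G_2$ of two vertex-disjoint graphs has vertex set $V(G_1)\cup V(G_2)$ and edge set $E(G_1)\cup E(G_2)\cup\{v_1v_2 : v_1\in V(G_1), v_2\in V(G_2)\}$. For a vertex subset $A$, $e(A)$ is the number of edges with both endpoints in $A$, and $A^c = V(G)\setminus A$. For a graph $G$ on an even number of vertices, $D_{2,\infty}^b(G) = \min \max\{e(A), e(A^c)\}$ over all partitions $V(G) = A\cup A^c$ with $|A| = |A^c|$. *)

(* Defs.v *)
From mathcomp Require Import all_boot.

Set Implicit Arguments.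
Unset Strict Implicit.
Unset Printing Implicit Defensive.

Record sgraph := SGraph {
  vertex :> finType;
  adj : rel vertex;
  adj_sym : symmetric adj;
  adj_irrefl : irreflexive adj }.

Definition edges (G : sgraph) : {set {set G}} :=
  [set [set p.1; p.2] | p : G * G & adj p.1 p.2].

Definition num_edges_in (G : sgraph) (A : {set G}) : nat :=
  #|[set E in edges G | E \subset A]|.

Definition edgeless (G : sgraph) : Prop := forall x y : G, ~~ adj x y.

Definition triangle_free (G : sgraph) : Prop :=
  forall x y z : G, ~ [/\ adj x y, adj y z & adj x z].

Section Join.
Variables G1 G2 : sgraph.

Definition join_adj : rel (G1 + G2) := fun u v =>
  match u, v with
  | inl x, inl y => adj x y
  | inr x, inr y => adj x y
  | _, _ => true
  end.

Lemma join_adj_sym : symmetric join_adj.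
Proof. by case=> x [] y //=; exact: adj_sym. Qed.

Lemma join_adj_irrefl : irreflexive join_adj.
Proof. by case=> x /=; exact: adj_irrefl. Qed.

(* The disjoint sum of the vertex types makes the two graphs vertex-disjoint. *)
Definition join : sgraph := SGraph join_adj_sym join_adj_irrefl.
End Join.

Definition balanced (G : sgraph) (A : {set G}) : bool := #|A| == #|~: A|.

Definition bipartition_cost (G : sgraph) (A : {set G}) : nat :=
  maxn (num_edges_in A) (num_edges_in (~: A)).

(* The default [num_edges_in [set: G]] bounds every cost from above, so it does
   not affect the minimum unless #|G| is odd and there is no balanced A;
   see [D2infb_le] and [D2infb_attained]. *)
Definition D2infb (G : sgraph) : nat :=
  \big[minn/num_edges_in [set: G]]_(A : {set G} | balanced A)
    bipartition_cost A.

Lemma num_edges_in_leT (G : sgraph) (A : {set G}) :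
  num_edges_in A <= num_edges_in [set: G].
Proof.
apply/subset_leq_card/subsetP => E; rewrite !inE => /andP[-> _].
exact: subsetT.
Qed.

Lemma D2infb_le (G : sgraph) (A : {set G}) :
  balanced A -> D2infb G <= bipartition_cost A.
Proof.
rewrite /D2infb => bA; have: A \in index_enum {set G} by rewrite mem_index_enum.
elim: (index_enum _) => // B s IHs; rewrite inE big_cons => /predU1P[<-|As].
  by rewrite bA geq_minl.
by case: ifP => _; rewrite ?geq_min IHs ?orbT.
Qed.

Lemma balanced_exists (G : sgraph) :
  ~~ odd #|G| -> exists A : {set G}, balanced A.
Proof.
move=> evG; pose A := [set x in take #|G|./2 (enum G)]; exists A.
have szA : #|A| = #|G|./2.
  rewrite cardsE (card_uniqP _) ?take_uniq ?enum_uniq // size_takel // -cardE.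
  by rewrite -{2}(odd_double_half #|G|) -addnn addnA leq_addl.
rewrite /balanced -(eqn_add2l #|A|) cardsC szA addnn.
by rewrite -{2}(odd_double_half #|G|) (negbTE evG).
Qed.

Lemma D2infb_attained (G : sgraph) : ~~ odd #|G| ->
  exists2 A : {set G}, balanced A & D2infb G = bipartition_cost A.
Proof.
case/balanced_exists => A0 bA0.
have: D2infb G = num_edges_in [set: G] \/
      exists2 A : {set G}, balanced A & D2infb G = bipartition_cost A.
  rewrite /D2infb; elim/big_ind: _ => [|m n Km Kn|A bA]; first by left.
    by rewrite /minn; case: ifP.
  by right; exists A.
case=> // D_E; exists A0 => //; apply/eqP; rewrite eqn_leq D2infb_le //= D_E.
by rewrite geq_max !num_edges_in_leT.
Qed.

(* Main.v *)
Require Import Defs.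
From mathcomp Require Import all_boot all_order all_algebra.
From mathcomp Require Import ring lra.

(* Let v be a vertex of maximum degree of T, S its neighbourhood (independent,
   as T is triangle-free) and S' the rest of T.  Give the vertices of I, S, S'
   constant weights i, x, y in [0, 1] of total n/2; the weighted edge count
   sum_(uw edge) f u * f w then depends only on the class sizes, on e(S, S') and
   on e(S').  Maximality of deg v bounds the degree sum over S' by |S||S'| and
   that over S by |S|^2, and under these two constraints suitable weights make
   the weighted counts of f and of 1 - f both at most (11/160) n^2, which is
   (1/1440) n^2 below the required bound.

   A fractional weighting f is rounded to a balanced set by repeatedly moving
   weight between two fractional vertices u and w until one is integral.  The
   count is concave along such a move, so one of the two directions does not
   increase it; and the count of 1 - f differs from that of f by a term linear
   in sum_v f v * deg v, which hardly changes when u and w have close degrees.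
   By pigeonhole such a pair exists as long as more than a constant number of
   vertices are fractional. *)

Set Implicit Arguments.
Unset Strict Implicit.
Unset Printing Implicit Defensive.
Import Order.TTheory GRing.Theory Num.Theory.
Local Open Scope ring_scope.

(** * Rounding a weighting of the vertices *)

Section Rounding.
Variable G : sgraph.
Implicit Types (f g : G -> rat) (A : {set G}).

Definition wdeg f (u : G) : rat := \sum_(w | adj u w) f w.
(* A sum over ordered pairs, so it is twice the weighted number of edges. *)
Definition energy f : rat := \sum_u f u * wdeg f u.

Definition deg (u : G) : nat := #|[set w | adj u w]|.
Definition degsum f : rat := \sum_u f u * (deg u)%:R.

Lemma energyE f : energy f = \sum_u \sum_w (adj u w)%:R * (f u * f w).
Proof.
apply: eq_bigr => u _; rewrite /wdeg big_mkcond mulr_sumr.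
apply: eq_bigr => w _.
by case: adj; rewrite ?mul1r ?mul0r ?mulr0.
Qed.

Lemma wdeg1 u : wdeg (fun=> 1) u = (deg u)%:R.
Proof.
rewrite /wdeg /deg sumr_const; congr _%:R.
by apply: eq_card => w; rewrite inE.
Qed.

(** Expand each product (1 - f u)(1 - f w); both linear terms sum to [degsum f]. Rounding therefore
    only has to track [energy] and [degsum]. *)
Lemma energy_compl f :
  energy (fun u => 1 - f u) = energy (fun=> 1) - 2 * degsum f + energy f.
Proof.
have cross : \sum_u \sum_w (adj u w)%:R * f w = degsum f.
  rewrite /degsum exchange_big; apply: eq_bigr => u _.
  rewrite -mulr_suml mulrC; congr (_ * _).
  rewrite -wdeg1 /wdeg [RHS]big_mkcond; apply: eq_bigr => w _ /=.
  by rewrite adj_sym; case: adj.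
have cross' : \sum_u \sum_w (adj u w)%:R * f u = degsum f.
  rewrite exchange_big -cross; apply: eq_bigr => u _; apply: eq_bigr => w _.
  by rewrite adj_sym.
rewrite !energyE mulr_natl mulr2n -{1}cross -cross' opprD addrA.
rewrite -!sumrB -big_split; apply: eq_bigr => u _ /=.
rewrite -!sumrB -big_split; apply: eq_bigr => w _ /=.
by ring.
Qed.

(** * Moving weight between two vertices *)

Definition shift f u w t : G -> rat :=
  fun v => f v + t * ((v == u)%:R - (v == w)%:R).

Lemma sum_delta f u : \sum_v (v == u)%:R * f v = f u.
Proof.
rewrite (bigD1 u) //= eqxx mul1r big1 ?addr0 // => v /negPf->.
by rewrite mul0r.
Qed.

Lemma wdeg_linear f g t u :
  wdeg (fun v => f v + t * g v) u = wdeg f u + t * wdeg g u.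
Proof. by rewrite /wdeg big_split /= mulr_sumr. Qed.

Lemma wdeg_sym f g : \sum_u g u * wdeg f u = \sum_u f u * wdeg g u.
Proof.
under eq_bigr do rewrite /wdeg mulr_sumr big_mkcond.
rewrite exchange_big; apply: eq_bigr => u _.
rewrite /wdeg mulr_sumr [RHS]big_mkcond.
by apply: eq_bigr => w _; rewrite adj_sym mulrC.
Qed.

(** The energy is a quadratic form; on the direction [h], +1 at [u] and -1 at [w], it takes the
    value -2 if [u] and [w] are adjacent and 0 otherwise. *)
Lemma energy_shift f u w t : u != w ->
  energy (shift f u w t) =
    energy f + 2 * t * (wdeg f u - wdeg f w) - 2 * (adj u w)%:R * t ^+ 2.
Proof.
move=> uw; pose h v : rat := (v == u)%:R - (v == w)%:R.
have sumh k : \sum_v h v * k v = k u - k w.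
  by under eq_bigr do rewrite mulrBl; rewrite sumrB !sum_delta.
have wh v : wdeg h v = (adj v u)%:R - (adj v w)%:R.
  rewrite /wdeg /h sumrB; congr (_ - _).
    rewrite big_mkcond -(sum_delta (fun x => (adj v x)%:R) u).
    by apply: eq_bigr => x _; case: adj; rewrite ?mulr1 ?mulr0.
  rewrite big_mkcond -(sum_delta (fun x => (adj v x)%:R) w).
  by apply: eq_bigr => x _; case: adj; rewrite ?mulr1 ?mulr0.
have -> : energy (shift f u w t) = energy f + 2 * t * (\sum_v h v * wdeg f v)
    + t ^+ 2 * (\sum_v h v * wdeg h v).
  transitivity (energy f + t * (\sum_v f v * wdeg h v)
      + t * (\sum_v h v * wdeg f v) + t ^+ 2 * (\sum_v h v * wdeg h v)).
    rewrite /energy !mulr_sumr -!big_split; apply: eq_bigr => v _ /=.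
    rewrite [wdeg _ v](wdeg_linear f h t).
    by rewrite /shift -/(h v); ring.
  by rewrite (wdeg_sym h f); ring.
rewrite !sumh !wh !adj_irrefl (adj_sym w u) /=; ring.
Qed.

Lemma sum_shift f u w t : \sum_v shift f u w t v = \sum_v f v.
Proof.
rewrite big_split -mulr_sumr sumrB /=.
have S z : \sum_(v : G) (v == z)%:R = 1 :> rat.
  rewrite -[RHS](sum_delta (fun=> 1) z).
  by apply: eq_bigr => v _; rewrite mulr1.
by rewrite !S subrr mulr0 addr0.
Qed.

Lemma degsum_shift f u w t :
  degsum (shift f u w t) = degsum f + t * ((deg u)%:R - (deg w)%:R).
Proof.
rewrite /degsum /shift; under eq_bigr do rewrite mulrDl -mulrA mulrBl.
by rewrite big_split -mulr_sumr sumrB !sum_delta.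
Qed.


(** * Reducing the number of fractional vertices *)

Definition fractional f : {set G} := [set v | (f v != 0) && (f v != 1)].

Lemma round_pair f u w : (forall v, 0 <= f v <= 1) ->
  u != w -> u \in fractional f -> w \in fractional f ->
  exists g, [/\ forall v, 0 <= g v <= 1, fractional g \proper fractional f,
    \sum_v g v = \sum_v f v, energy g <= energy f &
    degsum f - degsum g <= `|(deg u)%:R - (deg w)%:R|].
Proof.
move=> f01 uw uF wF.
have in01 v : v \in fractional f -> 0 < f v < 1.
  rewrite inE => /andP[v0 v1]; have /andP[] := f01 v.
  by rewrite !lt_neqAle v1 eq_sym v0 => -> ->.
have /andP[u0 u1] := in01 u uF; have /andP[w0 w1] := in01 w wF.
have wu : (w == u) = false by rewrite eq_sym (negPf uw).
have shu t : shift f u w t u = f u + t.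
  by rewrite /shift eqxx (negPf uw) subr0 mulr1.
have shw t : shift f u w t w = f w - t.
  by rewrite /shift eqxx wu sub0r mulrN1.
have sho t v : v != u -> v != w -> shift f u w t v = f v.
  by move=> vu vw; rewrite /shift (negPf vu) (negPf vw) subrr mulr0 addr0.
suff [t [tu tw tE]] : exists t, [/\ 0 <= f u + t <= 1, 0 <= f w - t <= 1 &
    t * (wdeg f u - wdeg f w) <= 0 /\
    [\/ f u + t = 0, f u + t = 1, f w - t = 0 | f w - t = 1]].
  case: tE => t_le t_int.
  exists (shift f u w t); split.
  - move=> v; have [->|vu] := eqVneq v u; first by rewrite shu.
    have [->|vw] := eqVneq v w; first by rewrite shw.
    by rewrite sho.
  - have sub : fractional (shift f u w t) \subset fractional f.
      apply/subsetP => v; have [->//|vu] := eqVneq v u.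
      have [->//|vw] := eqVneq v w.
      by rewrite !inE sho.
    rewrite properE sub; apply/subsetPn.
    by case: t_int => tE; [exists u|exists u|exists w|exists w] => //;
      rewrite inE ?shu ?shw tE eqxx ?andbF.
  - exact: sum_shift.
  - rewrite energy_shift //.
    have : 0 <= (adj u w)%:R * t ^+ 2 by rewrite mulr_ge0 ?sqr_ge0.
    lra.
  - rewrite degsum_shift opprD addrA subrr sub0r.
    apply: le_trans (ler_norm _) _; rewrite normrN normrM ler_piMl //.
    by rewrite ler_norml; lra.
(* The sign of t makes the linear term of [energy_shift] nonpositive; the
   quadratic one always is. *)
have [c|c] := lerP 0 (wdeg f u - wdeg f w).
  have [h|h] := lerP (f u) (1 - f w).
    exists (- f u); split; [lra|lra|split; last by constructor 1; lra].
    by rewrite mulNr oppr_le0 mulr_ge0 // ltW.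
  exists (f w - 1); split; [lra|lra|split; last by constructor 4; lra].
  by rewrite mulr_le0_ge0 //; lra.
have [h|h] := lerP (f w) (1 - f u).
  exists (f w); split; [lra|lra|split; last by constructor 3; lra].
  by rewrite mulr_ge0_le0 // ltW.
exists (1 - f u); split; [lra|lra|split; last by constructor 2; lra].
by rewrite mulr_ge0_le0 // ?ltW //; lra.
Qed.

Lemma deg_lt u : (deg u < #|G|)%N.
Proof.
apply: proper_card; apply/properP; split; first exact: subset_predT.
by exists u => //; rewrite inE adj_irrefl.
Qed.

Lemma close_degrees (F : {set G}) K : (0 < K < #|F|)%N ->
  exists u w, [/\ u \in F, w \in F, u != w &
    `|(deg u)%:R - (deg w)%:R| <= #|G|%:R / K%:R :> rat].
Proof.
case/andP=> K0 KF.
(* Pigeonhole: the degrees fall into [K] classes of width #|G| / K. *)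
have cls u : (deg u * K %/ #|G| < K)%N.
  rewrite ltn_divLR ?(leq_ltn_trans _ (deg_lt u)) //.
  by rewrite mulnC ltn_pmul2l ?deg_lt.
pose c u : 'I_K := Ordinal (cls u).
have /dinjectivePn[u uF [w]] : ~~ dinjectiveb c (mem F).
  apply/negP => /dinjectiveP inj.
  have := max_card (mem (c @: F)).
  by rewrite card_in_imset // card_ord leqNgt KF.
rewrite inE => /andP[wu wF] /(congr1 val) /= cE.
exists u, w; split=> //; first by rewrite eq_sym.
have G0 : (0 < #|G|)%N by rewrite (leq_ltn_trans _ (deg_lt u)).
rewrite ler_pdivlMr ?ltr0n //.
have := divn_eq (deg u * K) #|G|; have := divn_eq (deg w * K) #|G|.
have := ltn_pmod (deg u * K) G0; have := ltn_pmod (deg w * K) G0.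
rewrite cE; move: (_ %/ _)%N (_ %% _)%N (_ %% _)%N => b s1 s2 l1 l2 e1 e2.
rewrite -[K%:R]ger0_norm // -normrM mulrBl -!natrM e1 e2 !natrD.
rewrite opprD addrACA subrr add0r ler_norml.
move: l1 l2; rewrite -!(ltr_nat rat).
have : 0 <= s1%:R :> rat by []. have : 0 <= s2%:R :> rat by [].
lra.
Qed.

(* The first |fractional f| - K steps use pairs of close degrees, the last K ones
   arbitrary pairs. *)
Lemma round_weights K f : (0 < K)%N -> (forall v, 0 <= f v <= 1) ->
  exists g, [/\ forall v, 0 <= g v <= 1, (#|fractional g| <= 1)%N,
    \sum_v g v = \sum_v f v, energy g <= energy f &
    degsum f - degsum g <=
      #|fractional f|%:R * (#|G|%:R / K%:R)
      + (minn #|fractional f| K)%:R * #|G|%:R].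
Proof.
move=> K0; have [k] := ubnP #|fractional f|.
elim: k f => // k IHk f /ltnSE fk f01.
have [f1|f1] := leqP #|fractional f| 1.
  by exists f; split=> //; rewrite subrr addr_ge0 ?mulr_ge0 ?invr_ge0.
have [u [w [uF wF uw close]]] : exists u w,
    [/\ u \in fractional f, w \in fractional f, u != w &
    `|(deg u)%:R - (deg w)%:R| <=
      #|G|%:R / K%:R + (#|fractional f| <= K)%:R * #|G|%:R :> rat].
  have [fK|Kf] := leqP #|fractional f| K.
    have /card_gt1P[u [w [uF wF uw]]] := f1.
    exists u, w; split=> //; rewrite mul1r ler_wpDl ?divr_ge0 //.
    have := deg_lt u; have := deg_lt w; rewrite -!(ltr_nat rat).
    have : 0 <= (deg u)%:R :> rat by []. have : 0 <= (deg w)%:R :> rat by [].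
    rewrite ler_norml; lra.
  have [|u [w [uF wF uw c]]] := @close_degrees (fractional f) K.
    by rewrite K0.
  by exists u, w; rewrite mul0r addr0.
have [g [g01 gF gs ge gd]] := round_pair f01 uw uF wF.
have gf := proper_card gF.
have [h [h01 h1 hs he hd]] := IHk g (leq_trans gf fk) g01.
exists h; split=> //; [by rewrite hs|exact: le_trans he ge|].
rewrite -(subrKA (degsum g)).
apply: le_trans (lerD (le_trans gd close) hd) _.
rewrite addrACA -{1}[_ / _]mul1r -!mulrDl lerD //.
  by rewrite ler_wpM2r ?divr_ge0 // -mulrS ler_nat.
(* A step with at most [K] fractional vertices lowers the [minn] by at least one, which pays for its
   arbitrary pair. *)
rewrite ler_wpM2r // -natrD ler_nat.
case: (leqP #|fractional f| K) => _; last by rewrite add0n geq_minr.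
by rewrite add1n (leq_ltn_trans (geq_minl _ _)).
Qed.

(** * From integral weights to vertex sets *)

Lemma num_edges_in_energy A :
  2 * (num_edges_in A)%:R <= energy (fun v => (v \in A)%:R) :> rat.
Proof.
pose P := [set p : G * G | [&& adj p.1 p.2, p.1 \in A & p.2 \in A]].
pose h (p : G * G) := [set p.1; p.2].
have -> : energy (fun v : G => (v \in A)%:R) = #|P|%:R.
  rewrite energyE pair_bigA -sum1_card natr_sum [RHS]big_mkcond /=.
  apply: eq_bigr => -[u w] _; rewrite !inE /=.
  by case: adj; case: (u \in A); case: (w \in A); rewrite ?mulr0 ?mulr1 ?mul0r.
rewrite -natrM ler_nat mulnC -sum_nat_const.
rewrite -sum1_card.
(* Each edge inside [A] is the image under [h] of both of its orientations. *)
rewrite (partition_big h [in [set E in edges G | E \subset A]]) /=; last first.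
  move=> [u w]; rewrite !inE /= => /and3P[uw uA wA]; apply/andP; split.
    by apply/imsetP; exists (u, w); rewrite ?inE.
  by rewrite subUset !sub1set uA.
apply: leq_sum => E; rewrite !inE => /andP[/imsetP[[u w] /= uw ->]].
rewrite inE /= in uw.
rewrite subUset !sub1set => /andP[uA wA].
rewrite sum1_card; apply/card_gt1P; exists (u, w), (w, u); split.
- by rewrite unfold_in /= inE /= uw uA wA /h /= eqxx.
- by rewrite unfold_in /= inE /= adj_sym uw uA wA /h /= setUC eqxx.
- by apply: contraTneq uw => -[-> _]; rewrite adj_irrefl.
Qed.

Lemma fractional_le1_indicator f n :
  (forall v, 0 <= f v <= 1) -> (#|fractional f| <= 1)%N ->
  \sum_v f v = n%:R -> exists A, f =1 (fun v => (v \in A)%:R).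
Proof.
move=> f01 fr fs; exists [set v | f v == 1].
suff F0 : fractional f = set0.
  move=> v; have : v \notin fractional f by rewrite F0 inE.
  by rewrite !inE negb_and !negbK; case: (f v =P 1) => [->|_] //=;
    rewrite orbF => /eqP.
apply/eqP; rewrite -subset0; apply/subsetP => u uF.
have out v : v != u -> f v = (f v == 1)%:R.
  move=> vu; have : v \notin fractional f.
    by apply: contraTN fr => vF; rewrite -ltnNge; apply/card_gt1P; exists v, u.
  by rewrite inE negb_and !negbK; case: (f v =P 1) => [->|_] //=;
    rewrite orbF => /eqP.
(* The other values sum to an integer k, so a single fractional value would put [n] strictly between
   k and k + 1. *)
move: fs; rewrite (bigD1 u) //= (eq_bigr _ out) -natr_sum.
move: uF; rewrite inE => /andP[u0 u1]; have /andP[] := f01 u.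
rewrite !le_eqVlt eq_sym (negPf u0) (negPf u1) /=.
move: (\sum_(_ | _) _)%N => k fu0 fu1 e.
have : k%:R < n%:R :> rat by lra.
have : n%:R < k.+1%:R :> rat by rewrite -natr1; lra.
by rewrite !ltr_nat ltnS leqNgt => /negPf->.
Qed.
End Rounding.

Lemma balanced_rounding (eps : rat) : 0 < eps -> exists N : nat,
  forall (G : sgraph) (f : G -> rat), (N <= #|G|)%N -> ~~ odd #|G| ->
  (forall v, 0 <= f v <= 1) -> \sum_v f v = #|G|%:R / 2 ->
  exists A : {set G}, [/\ balanced A,
    2 * (num_edges_in A)%:R <= energy f &
    2 * (num_edges_in (~: A))%:R <=
      energy (fun v => 1 - f v) + eps * #|G|%:R ^+ 2].
Proof.
move=> eps0; pose K := (Num.bound (4 / eps)).+1.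
have KE : 4 <= eps * K%:R.
  have := archi_boundP (divr_ge0 (ler0n _ 4) (ltW eps0)).
  rewrite ltr_pdivrMr // => h.
  rewrite mulrC; apply: ltW; apply: lt_le_trans h _.
  by rewrite ler_wpM2r ?(ltW eps0) // ler_nat.
(* With 4 <= eps K and K^2 <= #|G|, each of the two error terms of [round_weights] is at most
   (eps/4) #|G|^2. *)
exists (K * K)%N => G f NG evG f01 fs.
have nh : #|G|%:R = 2 * (#|G|./2)%:R :> rat.
  by rewrite -natrM mul2n even_halfK.
have fs' : \sum_v f v = (#|G|./2)%:R by rewrite fs nh; field.
have [g [g01 g1 gs ge gd]] := round_weights (ltn0Sn _ : (0 < K)%N) f01.
have [A gA] := fractional_le1_indicator g01 g1 (etrans gs fs').
have cA : #|A| = #|G|./2.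
  apply/eqP; rewrite -(eqr_nat rat) -fs' -gs (eq_bigr _ (fun v _ => gA v)).
  by rewrite -natr_sum -sum1_card [X in (X%:R)%R]big_mkcond.
have eqE (h k : G -> rat) : h =1 k -> energy h = energy k.
  move=> hk; rewrite !energyE; apply: eq_bigr => u _; apply: eq_bigr => w _.
  by rewrite !hk.
exists A; split.
- rewrite /balanced -(eqn_add2l #|A|) cardsC addnn cA.
  by rewrite even_halfK.
- by apply: le_trans (num_edges_in_energy A) _; rewrite -(eqE _ _ gA).
apply: le_trans (num_edges_in_energy (~: A)) _.
rewrite (eqE _ (fun v => 1 - g v)); last first.
  by move=> v; rewrite gA inE; case: (v \in A); rewrite /= ?subrr ?subr0.
rewrite !energy_compl.
suff : degsum f - degsum g <= eps / 2 * #|G|%:R ^+ 2 by lra.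
apply: le_trans gd _.
have K0 : 0 < K%:R :> rat by rewrite ltr0n.
have n0 : 0 <= #|G|%:R :> rat by [].
have KKn : K%:R * K%:R <= #|G|%:R :> rat by rewrite -natrM ler_nat.
have b1 : #|fractional f|%:R * (#|G|%:R / K%:R) <= eps / 4 * #|G|%:R ^+ 2.
  apply: (@le_trans _ _ (#|G|%:R * (#|G|%:R / K%:R))).
    by rewrite ler_wpM2r ?divr_ge0 ?ler_nat ?max_card.
  rewrite mulrA -expr2 mulrC ler_wpM2r ?sqr_ge0 //.
  by rewrite -[K%:R^-1]mul1r ler_pdivrMr //; lra.
have b2 : (minn #|fractional f| K)%:R * #|G|%:R <= eps / 4 * #|G|%:R ^+ 2.
  rewrite expr2 mulrA ler_wpM2r //.
  apply: (@le_trans _ _ K%:R); first by rewrite ler_nat geq_minr.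
  have : eps * (K%:R * K%:R) <= eps * #|G|%:R by rewrite ler_pM2l.
  have : 4 * K%:R <= eps * K%:R * K%:R by rewrite ler_pM2r.
  lra.
lra.
Qed.

(** * Optimizing the class weights *)

(* The parameters are a = |I|/n, d = |S|/n, r = |S'|/n, p = e(S, S')/n^2 and
   q = e(S')/n^2; the value is the weighted edge count over n^2. *)
Definition class_cost (F : pzRingType) (a d r p q i x y : F) : F :=
  i * a * (x * d + y * r) + x * y * p + y ^+ 2 * q.

(* The last hypothesis, and the last but one of [rest_side_cost_le], say that
   weight 0 on T, respectively weight 1/2 everywhere, does not suffice; weight 1
   on S and 1/10 on S' then does. *)
Lemma nbhd_side_cost_le (F : realFieldType) (d r p q m : F) : m = d + r ->
  0 <= d -> 0 <= r -> 0 <= q -> p + 2 * q <= d * r ->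
  m <= 1/2 -> 11/160 - m/2 + m^+2 <= p + q ->
  (d + r/10)*(1/2 - (d+r/10)) + p/10 + q/100 <= 11/160.
Proof.
move=> -> d0 r0 q0 pq hm h2.
have h3 : p/10 + q/100 <= d*r/10 by lra.
(* Since p + q <= d r <= m^2/4, the lower bound on p + q keeps m away from 1/2. *)
have s1 : 0 <= (d - r)^+2 := sqr_ge0 _.
have m1 : d + r <= 19/40.
  rewrite leNgt; apply/negP => hm'.
  have : 0 <= (d + r - 19/40)^+2 := sqr_ge0 _.
  lra.
suff : (d + r / 10) * (1 / 2 - (d + r / 10)) + d*r/10 <= 11/160 by lra.
have [hr|hr] := lerP r (27/100).
  have : 0 <= (d - 1/4 + r/20)^+2 by apply: sqr_ge0.
  nra.
have : d <= 19/40 - r by lra.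
nra.
Qed.

Lemma rest_side_cost_le (F : realFieldType) (d r p q m : F) : m = d + r ->
  0 <= d -> 0 <= r -> 0 <= q -> p + 2 * q <= d * r ->
  m <= 1/2 -> 11/40 - m + m^+2 <= p+q -> 11/160 - m/2 + m^+2 <= p + q ->
  (9/10*r)*(1/2 - 9/10*r) + 81/100*q <= 11/160.
Proof.
move=> em d0 r0 q0 pq hm h1 h2.
have hd : d = m - r by lra.
(* Once q is bounded by [hq], the cost is a concave quadratic in r; this square gives its
   maximum. *)
have s : 0 <= (r * (9/5) - (1/4+9/20 * m))^+2 by apply: sqr_ge0.
have hq : q <= (m - r) * r - (p+q) by rewrite -hd; lra.
have hh : (9/10*r)*(1/2 - 9/10*r) + 81/100*q <=
    (1/2+9/10 * m)^+2/8 - 81/100*(p+q).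
  lra.
(* The lower bounds [h1] and [h2] on p + q coincide at m = 33/80. *)
have [hM|hM] := lerP m (33/80).
  by have : 0 <= (33/80 - m)^+2 := sqr_ge0 _; nra.
nra.
Qed.

(* In this lemma and the next one T has more than half of the vertices, 1/2 + x
   of them, and I gets weight 1; here the rest of the weight is put on part of S
   and in the next lemma on all of S and part of S'. *)
Lemma part_nbhd_cost_le (F : realFieldType) (d r p q x : F) : x + 1/2 = d + r ->
  0 <= x -> x <= 1/2 -> 0 < d -> x <= d -> 0 <= q -> 0 <= r ->
  p + 2 * q <= d * r -> x ^+ 2 + 1/40 <= p + q ->
  (d - x) / d * p + q <= 11/160.
Proof.
move=> em x0 x1 d0 xd q0 r0 pq h.
have rE : r = x + 1/2 - d by lra.
(* If 2x <= d, the weight (d - x)/d is at least 1/2 and the cost is at most (d - x) r, a product of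
   two numbers with sum 1/2. *)
have [dx|dx] := lerP (2 * x) d.
  have h1 : (d - x) / d * p + q <= (d - x) / d * (p + 2 * q).
    suff : 0 <= (d - 2 * x) / d * q.
      have -> : (d - 2 * x) / d = 2 * ((d - x) / d) - 1 by field; lra.
      lra.
    by rewrite mulr_ge0 // divr_ge0; lra.
  have h2 : (d - x) / d * (p + 2 * q) <= (d - x) / d * (d * r).
    by rewrite ler_wpM2l // divr_ge0; lra.
  have h3 : (d - x) / d * (d * r) = (d - x) * r by field; lra.
  have : 0 <= (d - x - 1/4)^+2 := sqr_ge0 _.
  rewrite h3 rE in h2; lra.
rewrite -(ler_pM2l d0).
have -> : d * ((d - x) / d * p + q) = (d - x) * p + d * q by field; lra.
(* The left side equals x (p + 2q) - (2x - d)(p + q), with both coefficients nonnegative. *)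
have h1 : (d - x) * p + d * q <= x * (d * r) - (2 * x - d) * (x^+2 + 1/40).
  have : x * (p + 2 * q) <= x * (d * r) by rewrite ler_wpM2l.
  have : (2 * x - d) * (x^+2 + 1/40) <= (2 * x - d) * (p + q).
    by rewrite ler_wpM2l //; lra.
  lra.
apply: (le_trans h1); rewrite rE.
rewrite -subr_ge0.
have -> : d * (11/160) - (x * (d * (x + 1/2 - d)) - (2 * x - d) * (x^+2 + 1/40))
  = x * d ^+ 2 - (2 * x^+2 + x/2 - 7/160) * d + 2 * x * (x^+2 + 1/40) by field.
have [hx|hx] := lerP x (1/16).
  have : 2 * x^+2 + x/2 - 7/160 <= 0 by nra.
  nra.
(* Four times x times the quadratic in d is a square minus its discriminant. *)
have disc : (2 * x^+2 + x/2 - 7/160)^+2 <= 8 * x^+2 * (x^+2+1/40).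
  have : 0 <= (x * (x - 1/4))^+2 := sqr_ge0 _.
  have [h2|h2] := lerP x (29/100); nra.
have x00 : 0 < 4 * x by lra.
rewrite -(pmulr_rge0 _ x00).
have : 0 <= (2 * x * d - (2 * x^+2 + x/2 - 7/160))^+2 := sqr_ge0 _.
lra.
Qed.

Lemma beyond_nbhd_cost_le (F : realFieldType) (d r p q x : F) :
  x + 1/2 = d + r ->
  x <= 1/2 -> 0 <= d -> d < x -> 0 <= q ->
  p + 2 * q <= d * r -> 2 * (p + q) <= d * (d + r) -> x ^+ 2 + 1/40 <= p + q ->
  x * (1/2 - x) + (x - d) / r * p + ((x - d) / r) ^+ 2 * q <= 11/160
   /\ (1/2 / r)^+2 * q <= 11/160.
Proof.
move=> em x1 d0 dx q0 pq hd h.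
have r1 : 1/2 < r by lra.
have r0 : r != 0 by lra.
split; last first.
  rewrite expr_div_n mulrAC ler_pdivrMr ?exprn_gt0 //; last lra.
  have : q <= d * r - x^+2 - 1/40 by lra.
  have -> : d = x + 1/2 - r by lra.
  have : 0 <= (x - 1/4)^+2 := sqr_ge0 _.
  have : 0 <= (r - 1/2)^+2 := sqr_ge0 _.
  have : 0 <= (r - 1/2) * (1/2 - x) by rewrite mulr_ge0 //; lra.
  lra.
have w0 : 0 <= (x - d) / r by rewrite divr_ge0; lra.
have w1 : (x - d) / r <= 1 by rewrite ler_pdivrMr; lra.
have h1 : (x - d) / r * p + ((x - d) / r) ^+ 2 * q <= (x - d) / r * (p + 2 * q).
  move: (_ / r) w0 w1 => w w0 w1.
  have : 0 <= w * q * (2 - w) by rewrite !mulr_ge0 //; lra.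
  lra.
have h2 : (x - d) / r * (p + 2 * q) <= (x - d) * d.
  have <- : (x - d) / r * (d * r) = (x - d) * d by field.
  by rewrite ler_wpM2l.
suff : x * (1/2 - x) + (x - d) * d <= 11/160 by lra.
(* The degree bound [hd] enters here: S cannot be too small, as T has many edges. *)
have h3 : 2 * x^+2 + 1/20 <= d * (x + 1/2) by rewrite em; lra.
have h4 : (x - d) * (x + 1/2) <= x * (1/2 - x) - 1/20 by lra.
have h5 : (x - d) * d <= (x - d) * (x + 1/2) * (9/20).
  rewrite -subr_ge0.
  have -> : (x - d) * (x + 1/2) * (9/20) - (x - d) * d =
      (x - d) * (9/20 * x + 9/40 - d) by field.
  apply: mulr_ge0; first lra.
  have : 0 <= (x - d) * (x + 1/2) by rewrite mulr_ge0; lra.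
  nra.
have : 0 <= (x - 1/4)^+2 := sqr_ge0 _.
lra.
Qed.

Lemma exists_class_weights (F : realFieldType) (a d r p q : F) :
  0 <= a -> 0 <= d -> 0 <= r -> 0 <= q -> a + d + r = 1 ->
  p + 2 * q <= d * r -> 2 * (p + q) <= d * (d + r) ->
  exists i x y : F, [/\ [&& 0 <= i <= 1, 0 <= x <= 1 & 0 <= y <= 1],
    i * a + x * d + y * r = 1/2,
    class_cost a d r p q i x y <= 11/160 &
    class_cost a d r p q (1 - i) (1 - x) (1 - y) <= 11/160].
Proof.
move=> a0 d0 r0 q0 adr pq degs; rewrite /class_cost.
(* Weight 1/2 everywhere costs (m (1 - m) + p + q)/4 on both sides, where m = d + r; the threshold
   makes this 11/160. *)
have [half|half] := lerP (p + q) (11/40 - (d + r) + (d + r)^+2).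
  have aE : a = 1 - (d + r) by lra.
  exists (1/2), (1/2), (1/2); rewrite aE.
  by split; [apply/and3P; split; lra|lra|lra|lra].
have [m_lt|m_ge] := lerP (d + r) (1/2).
  have a1 : 0 < a by lra.
  (* With all the weight on I, the complement costs m (1/2 - m) + p + q. *)
  have [none|none] := lerP (p + q) (11/160 - (d + r)/2 + (d + r)^+2).
    exists (1/2 / a), 0, 0.
    rewrite [(1 - _ / a) * a]mulrBl ![_ / a * a]divfK ?gt_eqF //; split.
    - by rewrite divr_ge0 ?ler_pdivrMr //=; lra.
    - lra.
    - lra.
    - have -> : a = 1 - (d + r) by lra.
      lra.
  exists ((1/2 - d - r/10) / a), 1, (1/10).
  rewrite [_ * a]divfK ?gt_eqF // [(1 - _ / a) * a]mulrBl.
  rewrite [_ / a * a]divfK ?gt_eqF //; split.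
  - by rewrite divr_ge0 ?ler_pdivrMr //=; lra.
  - lra.
  - have := nbhd_side_cost_le erefl d0 r0 q0 pq m_lt (ltW none); lra.
  - have := rest_side_cost_le erefl d0 r0 q0 pq m_lt (ltW half) (ltW none).
    have -> : a = 1 - (d + r) by lra.
    lra.
have [x xE] : exists x, x + 1/2 = d + r by exists (d + r - 1/2); lra.
have aE : a = 1/2 - x by lra.
have L : x ^+ 2 + 1/40 <= p + q.
  by move: half; rewrite -xE; lra.
have x0 : 0 <= x by lra.
have x1 : x <= 1/2 by lra.
have [dx|dx] := lerP x d.
  have d1 : 0 < d.
    rewrite lt_neqAle d0 andbT eq_sym; apply/negP => /eqP dE.
    by move: degs; rewrite dE mul0r; have : 0 <= x^+2 := sqr_ge0 _; lra.
  have dn : d != 0 by rewrite gt_eqF.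
  exists 1, (x / d), 0; split.
  - by rewrite divr_ge0 ?ler_pdivrMr //=; lra.
  - by rewrite divfK //; lra.
  - rewrite divfK // aE; have : 0 <= (x - 1/4)^+2 := sqr_ge0 _; lra.
  - have := part_nbhd_cost_le xE x0 x1 d1 dx q0 r0 pq L.
    have -> : 1 - x / d = (d - x) / d by field.
    lra.
have rn : r != 0 by apply/negP => /eqP rE; lra.
have [c1 c2] := beyond_nbhd_cost_le xE x1 d0 dx q0 pq degs L.
have r1 : 0 < r by lra.
exists 1, 1, ((x - d) / r); split.
- by rewrite divr_ge0 ?ler_pdivrMr //=; lra.
- by rewrite divfK //; lra.
- by rewrite divfK // aE; lra.
- have -> : 1 - (x - d) / r = 1/2 / r.
    by apply: (mulIf rn); rewrite mulrBl !divfK //; lra.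
  lra.
Qed.

(** * Joins with a triangle-free graph *)

(** Ordered pairs are counted, so [links A A] is twice the number of edges inside [A]. *)
Definition links (G : sgraph) (A B : {set G}) : rat :=
  \sum_(u in A) \sum_(w in B) (adj u w)%:R.

Lemma links_sym (G : sgraph) (A B : {set G}) : links A B = links B A.
Proof.
rewrite /links exchange_big; apply: eq_bigr => u _; apply: eq_bigr => w _.
by rewrite adj_sym.
Qed.

Lemma links_ge0 (G : sgraph) (A B : {set G}) : 0 <= links A B.
Proof. by apply: sumr_ge0 => u _; apply: sumr_ge0 => w _. Qed.

Lemma links_deg (G : sgraph) (A N : {set G}) :
  links A N + links A (~: N) = \sum_(u in A) (deg u)%:R.
Proof.
rewrite -big_split; apply: eq_bigr => u _ /=.
rewrite -wdeg1 /wdeg big_mkcond [in RHS]big_mkcond /= [X in _ + X]big_mkcond.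
rewrite -big_split.
apply: eq_bigr => w _ /=; rewrite inE.
by case: (w \in N); case: adj; rewrite ?addr0 ?add0r.
Qed.

(** [N] is the neighbourhood of a vertex of maximum degree: an edge inside it would close a
    triangle, and the two bounds sum degrees, all at most #|N|, over [~: N] and over [N]. *)
Lemma triangle_free_neighborhood (T : sgraph) : triangle_free T ->
  exists N : {set T}, [/\ links N N = 0,
    links N (~: N) + links (~: N) (~: N) <= #|N|%:R * #|~: N|%:R &
    links N (~: N) <= #|N|%:R ^+ 2].
Proof.
move=> tf; have [v0 _|T0] := pickP (fun _ : T => true); last first.
  have L A B : @links T A B = 0.
    by rewrite /links big1 // => u; have := T0 u.
  by exists set0; rewrite !L addr0 mulr_ge0 // sqr_ge0.
have [v _ vmax] := @arg_maxnP _ v0 predT (@deg T) isT.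
exists [set w | adj v w]; set N := [set w | adj v w].
have NN : links N N = 0.
  rewrite /links big1 // => u uN; rewrite big1 // => w wN.
  move: uN wN; rewrite !inE => vu vw.
  by case uw: (adj u w) => //; case: (tf v u w).
have sum_deg (A : {set T}) : links A N + links A (~: N) <= #|N|%:R * #|A|%:R.
  rewrite links_deg mulr_natr -sumr_const.
  by apply: ler_sum => u _; rewrite ler_nat; apply: vmax.
split=> //; first by rewrite {1}links_sym.
by rewrite expr2; apply: le_trans (sum_deg N); rewrite NN add0r.
Qed.

Lemma energy_two_values (T : sgraph) (N : {set T}) (x y : rat) :
  energy (fun u : T => if u \in N then x else y) =
    x ^+ 2 * links N N + 2 * (x * y) * links N (~: N)
    + y ^+ 2 * links (~: N) (~: N).
Proof.
have split2 (c : T -> rat) :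
    \sum_u c u * (if u \in N then x else y) =
    x * (\sum_(u in N) c u) + y * (\sum_(u in ~: N) c u).
  rewrite (bigID (mem N)) /= !mulr_sumr; congr (_ + _).
    by apply: eq_bigr => u uN; rewrite uN mulrC.
  by apply: eq_big => u; [rewrite inE|move/negPf=> uN; rewrite uN mulrC].
rewrite /energy; under eq_bigr do rewrite mulrC; rewrite split2.
have wE u : wdeg (fun w => if w \in N then x else y) u =
    x * (\sum_(w in N) (adj u w)%:R) + y * (\sum_(w in ~: N) (adj u w)%:R).
  rewrite /wdeg big_mkcond -split2; apply: eq_bigr => w _.
  by case: adj; rewrite ?mul1r ?mul0r.
under eq_bigr do rewrite wE.
under [X in _ + y * X]eq_bigr do rewrite wE.
rewrite !big_split -!mulr_sumr /= -!/(links _ _) (links_sym (~: N) N); ring.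
Qed.

Lemma energy_join (I T : sgraph) (f : join I T -> rat) : edgeless I ->
  energy f = 2 * (\sum_(u : I) f (inl u)) * (\sum_(u : T) f (inr u))
   + energy (fun u : T => f (inr u)).
Proof.
move=> I0; rewrite !energyE big_sumType /=.
have II u : \sum_w (adj (inl u : join I T) w)%:R * (f (inl u) * f w) =
    f (inl u) * \sum_(w : T) f (inr w).
  rewrite big_sumType /= big1 ?add0r; last first.
    by move=> w _; rewrite (negPf (I0 u w)) mul0r.
  by rewrite mulr_sumr; apply: eq_bigr => w _; rewrite mul1r.
have TI u : \sum_w (adj (inr u : join I T) w)%:R * (f (inr u) * f w) =
    f (inr u) * (\sum_(w : I) f (inl w))
    + \sum_w (adj u w)%:R * (f (inr u) * f (inr w)).
  rewrite big_sumType /=; congr (_ + _).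
  by rewrite mulr_sumr; apply: eq_bigr => w _; rewrite mul1r.
rewrite (eq_bigr _ (fun u _ => II u)) (eq_bigr _ (fun u _ => TI u)).
by rewrite big_split /= -!mulr_suml; ring.
Qed.

Lemma D2infb_join_le (eps : rat) : 0 < eps -> exists N : nat,
  forall I T : sgraph, (N <= #|join I T|)%N -> ~~ odd #|join I T| ->
  edgeless I -> triangle_free T ->
  (D2infb (join I T))%:R <= (11/160 + eps) * #|join I T|%:R ^+ 2 :> rat.
Proof.
(* Rounding is applied with 2 eps because its estimates concern twice the number of edges. *)
move=> eps0; have [N HN] := balanced_rounding (mulr_gt0 (ltr0n _ 2) eps0).
exists (maxn N 1) => I T; rewrite geq_max => /andP[Nn n1] evn I0 tf.
have [n nE] : exists n, n = #|join I T| by exists #|join I T|.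
rewrite -nE in n1 *.
have n0 : 0 < n%:R :> rat by rewrite ltr0n.
have nn : n%:R != 0 :> rat by rewrite gt_eqF.
have [S [SS sumS sqS]] := triangle_free_neighborhood tf.
have cardI : #|I|%:R + #|S|%:R + #|~: S|%:R = n%:R :> rat.
  by rewrite nE -addrA -!natrD cardsC card_sum.
pose a : rat := #|I|%:R / n%:R; pose d : rat := #|S|%:R / n%:R.
pose r : rat := #|~: S|%:R / n%:R.
pose p := links S (~: S) / n%:R ^+ 2.
pose q := links (~: S) (~: S) / (2 * n%:R ^+ 2).
have n2 : 0 < 2 * n%:R ^+ 2 :> rat by rewrite mulr_gt0 // exprn_gt0.
have [|||||||i [x [y [/and3P[i01 x01 y01] tot c1 c2]]]] :=
  @exists_class_weights rat a d r p q.
- by rewrite divr_ge0.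
- by rewrite divr_ge0.
- by rewrite divr_ge0.
- by rewrite divr_ge0 ?links_ge0 // ltW.
- by rewrite -!mulrDl cardI divff.
- rewrite -(ler_pM2r (exprn_gt0 2 n0)) /p /q /d /r.
  apply: etrans (_ : _ = (links S (~: S) + links (~: S) (~: S) <=
    #|S|%:R * #|~: S|%:R)) sumS.
  by congr (_ <= _); field.
(* Scaled by n^2, this is the sum of [sumS] and [sqS]. *)
- rewrite -(ler_pM2r (exprn_gt0 2 n0)) /p /q /d /r.
  apply: etrans (_ : _ = (2 * links S (~: S) + links (~: S) (~: S) <=
    #|S|%:R ^+ 2 + #|S|%:R * #|~: S|%:R)) _; last lra.
  by congr (_ <= _); field.
pose f i x y (v : join I T) : rat :=
  match v with inl _ => i | inr u => if u \in S then x else y end.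
have sumT x' y' : \sum_(u : T) (if u \in S then x' else y') =
    x' * #|S|%:R + y' * #|~: S|%:R :> rat.
  rewrite (bigID (mem S)) /=; congr (_ + _).
    by under eq_bigr => u uS do rewrite uS; rewrite sumr_const mulr_natr.
  under eq_bigr => u uS do rewrite (negPf uS).
  rewrite sumr_const mulr_natr; congr (_ *+ _).
  by apply: eq_card => u; rewrite !inE.
have energy_f i' x' y' :
    energy (f i' x' y') = 2 * n%:R ^+ 2 * class_cost a d r p q i' x' y'.
  rewrite energy_join //= energy_two_values SS sumT sumr_const -mulr_natr.
  by rewrite /class_cost /a /d /r /p /q; field.
have [//|//|||A [bA e1 e2]] := HN (join I T) (f i x y).
- by case=> // u; rewrite /f; case: ifP.
- rewrite big_sumType /= sumr_const sumT -nE -mulr_natr.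
  move: (congr1 (fun t => t * n%:R) tot).
  rewrite (_ : 1/2 * n%:R = n%:R / 2); last by field.
  by move <-; rewrite /a /d /r; field.
have e2' : energy (fun v => 1 - f i x y v) = energy (f (1 - i) (1 - x) (1 - y)).
  rewrite !energyE; apply: eq_bigr => u _; apply: eq_bigr => w _.
  by congr (_ * (_ * _)); rewrite /f; [case: u|case: w] => // z; case: ifP.
rewrite e2' -nE energy_f in e2; rewrite energy_f in e1.
rewrite -(ler_pM2l n2) in c1; rewrite -(ler_pM2l n2) in c2.
apply: (@le_trans _ _ (bipartition_cost A)%:R).
  by rewrite ler_nat D2infb_le.
rewrite /bipartition_cost /maxn; case: ifP => _.
  by move: (le_trans e2 (lerD c2 (lexx _))); lra.
move: (le_trans e1 c1) => h.
have : 0 <= eps * n%:R ^+ 2 by rewrite mulr_ge0 ?sqr_ge0 // ltW.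
lra.
Qed.

Local Close Scope ring_scope.

Theorem theorem1p9 :
  exists N : nat, forall n : nat, N <= n -> ~~ odd n ->
  forall I T : sgraph, edgeless I -> triangle_free T -> #|join I T| = n ->
  ((D2infb (join I T))%:R <= 5%:R / 72%:R * n%:R ^+ 2 :> rat)%R.
Proof.
(* 5/72 = 11/160 + 1/1440. *)
have [N HN] := @D2infb_join_le (1%:R / 1440%:R)%R isT.
exists N => n Nn evn I T I0 tf nE.
have := HN I T; rewrite nE => /(_ Nn evn I0 tf).
lra.
Qed.
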